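(* Let $X$ be a Lowen fuzzy topological space. Under the identification $C(X,\mathbb{S})=\tau_X$, the set $\Sigma_X$ of all Scott-continuous maps $\Phi:\tau_X\to\mathbb{I}$ satisfying finite-tier compatibility is a Lowen fuzzy topology on $C(X,\mathbb{S})$, and it is the largest splitting topology on $C(X,\mathbb{S})$: it is splitting, and every splitting Lowen topology $\eta$ on $C(X,\mathbb{S})$ satisfies $\eta\subseteq\Sigma_X$.
   Context: Let $\mathbb{I}=[0,1]$ with its usual order; $\underline{a}$ denotes the constant map with value $a\in\mathbb{I}$; joins $\bigvee$ and meets $\wedge$ of $\mathbb{I}$-valued maps are pointwise suprema and minima. A (stratified) Lowen fuzzy topology on a set $X$ is a subset $\tau_X\subseteq\mathbb{I}^X$ containing all constant maps and closed under arbitrary pointwise joins and finite pointwise meets; $(X,\tau_X)$ is then called a Lowen (fuzzy topological) space and members of $\tau_X$ are called fuzzy open. A map $f:X\to Y$ is continuous if $v\circ f\in\tau_X$ for all $v\in\tau_Y$. $C(X,Y)$ is the set of continuous maps. The product $Z\times X$ carries the Lowen topology generated by (i.e. the least one containing) the maps $a\circ\mathrm{pr}_Z$, $a\in\tau_Z$, and $b\circ\mathrm{pr}_X$, $b\in\tau_X$; similarly for finite products. The Lowen fuzzy Sierpiński object is $\mathbb{S}=(\mathbb{I},\delta_{\mathbb{S}})$, where $\delta_{\mathbb{S}}$ is the least Lowen topology on $\mathbb{I}$ containing $\mathrm{id}_{\mathbb{I}}$. A map $u:X\to\mathbb{I}$ belongs to $\tau_X$ iff it is continuous as a map $X\to\mathbb{S}$;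 thus $C(X,\mathbb{S})=\tau_X$. Splitting: a Lowen topology $\eta$ on the set $C(X,Y)$ is splitting if, for every Lowen space $Z$, every continuous $H:Z\times X\to Y$ has continuous transpose $\widehat H:Z\to(C(X,Y),\eta)$, $\widehat H(z)=H(z,\cdot)$. Weights: regard $\tau_X$ as a complete lattice in the pointwise order; directed sets are nonempty. A map $\Phi:\tau_X\to\mathbb{I}$ is Scott-continuous if it is monotone and $\Phi(\bigvee D)=\bigvee_{\mu\in D}\Phi(\mu)$ for every directed $D\subseteq\tau_X$. It satisfies finite-tier compatibility (FTC) if for every $n\ge 1$ and $\beta_1,\dots,\beta_n\in\tau_X$ the map $\mathbb{I}^n\to\mathbb{I}$, $(r_1,\dots,r_n)\mapsto\Phi\bigl(\bigvee_{i=1}^n(\underline{r_i}\wedge\beta_i)\bigr)$ is fuzzy open in the product $\mathbb{S}^n$. $\Sigma_X\subseteq\mathbb{I}^{\tau_X}$ is the set of all Scott-continuous maps satisfying FTC. *)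

(* Defs.v *)
From mathcomp Require Import all_boot all_order all_algebra.
From mathcomp Require Import all_classical reals interval_inference.

Set Implicit Arguments.
Unset Strict Implicit.
Unset Printing Implicit Defensive.

Import Order.TTheory GRing.Theory Num.Theory.
Local Open Scope classical_set_scope.
Local Open Scope ring_scope.

(* The base point only serves as the value of the empty join: see isupP. *)
Definition isup (R : realType) (A : set {i01 R}) : {i01 R} :=
  supremum 0%:i01 A.

Lemma isupP (R : realType) (A : set {i01 R}) : supremums A (isup A).
Proof.
rewrite /isup /supremum; case: eqP => [->|/eqP A0].
  split=> [x []//|x _]; rewrite -num_le; exact: ge0.
suff [s As] : supremums A !=set0 by exact: (xgetPex 0%:i01 (ex_intro _ s As)).
have /set0P[a Aa] := A0.
pose B : set R := [set x%:num | x in A].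
have supB : has_sup B.
  split; first by exists a%:num, a.
  by exists 1 => _ [x _ <-]; exact: le1.
have ubB x : A x -> x%:num <= sup B.
  by move=> Ax; apply: (ub_le_sup supB.2); exists x.
have s0 : 0 <= sup B by apply: le_trans (ubB a Aa); exact: ge0.
have s1 : sup B <= 1 by apply: ge_sup supB.1 _ => _ [x _ <-]; exact: le1.
exists (Itv01 s0 s1); split=> [x Ax|y yA]; rewrite -num_le; first exact: ubB.
apply: ge_sup supB.1 _ => _ [x Ax <-].
by rewrite num_le; exact: yA.
Qed.

Definition pjoin (R : realType) (T : Type) (F : set (T -> {i01 R})) :
  T -> {i01 R} := fun x => isup [set u x | u in F].

Definition pmeet (R : realType) (T : Type) (u v : T -> {i01 R}) :
  T -> {i01 R} := fun x => Order.min (u x) (v x).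

(* The meet of the empty family is the constant map 1, so that finite meets
   reduce to binary ones. *)
Definition lowen_topology (R : realType) (T : Type)
    (tau : set (T -> {i01 R})) : Prop :=
  [/\ forall a : {i01 R}, tau (fun=> a),
      forall F : set (T -> {i01 R}), F `<=` tau -> tau (pjoin F) &
      forall u v, tau u -> tau v -> tau (pmeet u v)].

Record lowenType (R : realType) := LowenType {
  lowen_carrier :> Type;
  fopen : set (lowen_carrier -> {i01 R});
  fopenP : lowen_topology fopen }.
Arguments fopen {R} l.
Arguments fopenP {R} l.

Definition generated (R : realType) (T : Type) (G : set (T -> {i01 R})) :
  set (T -> {i01 R}) := smallest (@lowen_topology R T) G.

Lemma generated_lowen (R : realType) (T : Type) (G : set (T -> {i01 R})) :
  lowen_topology (generated G).
Proof.
split=> [a tau [[tauc _ _] _]//|F FG tau tauG|u v uG vG tau tauG].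
  have [[_ tauj _] _] := tauG.
  by apply: tauj => u Fu; exact: FG Fu _ tauG.
have [[_ _ taum] _] := tauG.
by apply: taum; [exact: uG | exact: vG].
Qed.

Definition fcontinuous (R : realType) (X Y : lowenType R) (f : X -> Y) : Prop :=
  forall v, fopen Y v -> fopen X (v \o f).

(* The set C(X, Y); it is also used as a type, through set_type. *)
Definition cmaps (R : realType) (X Y : lowenType R) : set (X -> Y) :=
  [set f | fcontinuous f].
Arguments cmaps {R} X Y.

Definition prod_lowen (R : realType) (Z X : lowenType R) : lowenType R :=
  LowenType (generated_lowen
    ([set a \o @fst Z X | a in fopen Z] `|` [set b \o @snd Z X | b in fopen X])).

Definition pow_lowen (R : realType) (n : nat) (Y : lowenType R) : lowenType R :=
  LowenType (generated_lowen
    (\bigcup_(i : 'I_n) [set (fun r : 'I_n -> Y => a (r i)) | a in fopen Y])).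

Definition sierpinski (R : realType) : lowenType R :=
  LowenType (generated_lowen [set (id : {i01 R} -> {i01 R})]).
Arguments sierpinski R : clear implicits.

Lemma fcontinuous_section (R : realType) (Z X Y : lowenType R)
    (H : prod_lowen Z X -> Y) (z : Z) :
  fcontinuous H -> fcontinuous (fun x : X => H (z, x)).
Proof.
move=> Hc v /Hc vH.
have [Xc Xj Xm] := fopenP X.
pose tau : set (Z * X -> {i01 R}) := [set w | fopen X (fun x => w (z, x))].
apply: (vH tau); split; last first.
  by move=> _ [[a _ <-]|[b bX <-]]; [exact: (Xc (a z)) | exact: bX].
split=> [a|F Ftau|u w]; [exact: (Xc a)| |exact: Xm].
have -> : tau (pjoin F) =
    fopen X (pjoin [set (fun x => u (z, x)) | u in F]).
  rewrite /tau /pjoin /=; congr (fopen X _); apply/funext => x; congr isup.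
  apply/seteqP; split=> [_ [u Fu <-]|_ [_ [u Fu <-] <-]]; last by exists u.
  by exists (fun x => u (z, x)) => //; exists u.
by apply: Xj => _ [u /Ftau ? <-].
Qed.

Definition transpose (R : realType) (Z X Y : lowenType R)
    (H : prod_lowen Z X -> Y) (Hc : fcontinuous H) (z : Z) : cmaps X Y :=
  SigSub (mem_set (fcontinuous_section z Hc : cmaps X Y (fun x => H (z, x)))).

Definition splitting (R : realType) (X Y : lowenType R)
    (eta : set (cmaps X Y -> {i01 R})) (etaL : lowen_topology eta) : Prop :=
  forall (Z : lowenType R) (H : prod_lowen Z X -> Y) (Hc : fcontinuous H),
    @fcontinuous R Z (LowenType etaL) (transpose Hc).

Lemma fcontinuous_sierpinski (R : realType) (X : lowenType R)
    (u : X -> sierpinski R) : fcontinuous u <-> fopen X u.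
Proof.
have [Xc Xj Xm] := fopenP X.
split=> [uc|uX v vS]; first by apply: (uc id) => tau [_]; exact.
pose tau : set ({i01 R} -> {i01 R}) :=
  [set w : {i01 R} -> {i01 R} | fopen X (w \o u)].
apply: (vS tau); split; last by move=> _ ->.
split=> [a|F FX|w w']; [exact: (Xc a)| |exact: Xm].
rewrite /tau /=; have -> : pjoin F \o u =
    pjoin [set w \o (u : X -> {i01 R}) | w in F].
  apply/funext => x; congr isup.
  apply/seteqP; split=> [_ [w Fw <-]|_ [_ [w Fw <-] <-]]; last by exists w.
  by exists (w \o u) => //; exists w.
by apply: Xj => _ [w /FX ? <-].
Qed.

(* The identification C(X, S) = tau_X, in both directions; neither changes
   the underlying map. *)
Definition fopen_of_cmap (R : realType) (X : lowenType R)
    (f : cmaps X (sierpinski R)) : fopen X :=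
  SigSub (mem_set ((fcontinuous_sierpinski (val f)).1 (set_valP f))).

Definition cmap_of_fopen (R : realType) (X : lowenType R)
    (u : fopen X) : cmaps X (sierpinski R) :=
  SigSub (mem_set ((@fcontinuous_sierpinski R X (val u)).2 (set_valP u)
                   : cmaps X (sierpinski R) (val u))).

Lemma fopen_of_cmapK (R : realType) (X : lowenType R) :
  cancel (@fopen_of_cmap R X) (@cmap_of_fopen R X).
Proof. by move=> f; exact: val_inj. Qed.

Lemma cmap_of_fopenK (R : realType) (X : lowenType R) :
  cancel (@cmap_of_fopen R X) (@fopen_of_cmap R X).
Proof. by move=> u; exact: val_inj. Qed.

Section FopenLattice.
Variables (R : realType) (X : lowenType R).
Implicit Types (u v : fopen X) (D : set (fopen X)).

Definition fle u v : Prop := forall x, val u x <= val v x.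

Lemma fconst_subproof (a : {i01 R}) : fopen X (fun=> a).
Proof. by have [Xc _ _] := fopenP X; exact: Xc. Qed.

Definition fconst (a : {i01 R}) : fopen X :=
  SigSub (mem_set (fconst_subproof a)).

Lemma fmeet_subproof u v : fopen X (pmeet (val u) (val v)).
Proof. by have [_ _ Xm] := fopenP X; apply: Xm; exact: set_valP. Qed.

Definition fmeet u v : fopen X := SigSub (mem_set (fmeet_subproof u v)).

Lemma fjoin_subproof D : fopen X (pjoin [set val u | u in D]).
Proof.
by have [_ Xj _] := fopenP X; apply: Xj => _ [u _ <-]; exact: set_valP.
Qed.

Definition fjoin D : fopen X := SigSub (mem_set (fjoin_subproof D)).

Definition fdirected D : Prop :=
  D !=set0 /\
  forall u v, D u -> D v -> exists w, [/\ D w, fle u w & fle v w].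

Definition scott_continuous (Phi : fopen X -> {i01 R}) : Prop :=
  (forall u v, fle u v -> Phi u <= Phi v) /\
  (forall D, fdirected D -> Phi (fjoin D) = isup [set Phi u | u in D]).

Definition finite_tier_compatible (Phi : fopen X -> {i01 R}) : Prop :=
  forall (n : nat) (beta : 'I_n -> fopen X), (0 < n)%N ->
    fopen (pow_lowen n (sierpinski R))
      (fun r : 'I_n -> {i01 R} =>
         Phi (fjoin (range (fun i => fmeet (fconst (r i)) (beta i))))).

End FopenLattice.

Definition Sigma (R : realType) (X : lowenType R) : set (fopen X -> {i01 R}) :=
  [set Phi | scott_continuous Phi /\ finite_tier_compatible Phi].
Arguments Sigma {R} X.

Definition SigmaC (R : realType) (X : lowenType R) :
    set (cmaps X (sierpinski R) -> {i01 R}) :=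
  [set Phi \o @fopen_of_cmap R X | Phi in Sigma X].
Arguments SigmaC {R} X.

(* Main.v *)
Require Import Defs.
From mathcomp Require Import all_boot all_order all_algebra.
From mathcomp Require Import all_classical reals interval_inference.

(** An open map of [Z x X] is a join of rectangles [a(z) /\ b(x)], and an open
    map [H] of [Z x X] is the same thing as a continuous family
    [z |-> H(z, _)] of open maps of [X].  Both halves of the theorem are
    readings of these two facts.

    [Sigma X] is splitting.  Writing [H] as a join of rectangles shows each
    section [H(z, _)] to be the directed join, over all finite families of
    rectangles [(a_i, b_i)] below [H], of the tiers
    [\/_i (a_i(z) /\ b_i)].  Scott continuity of a weight [Phi] turns
    [Phi(H(z, _))] into the join of the values of [Phi] at these tiers, and
    finite-tier compatibility says that each such value is an open map of
    [(a_1(z), ..., a_n(z))], hence of [z] ([fopen_weight_section]).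

    [Sigma X] is the largest.  Let [Phi] belong to a splitting topology; then
    [z |-> Phi(H(z, _))] is open for every open [H].  With the power of the
    Sierpinski object as [Z] and [H(r, x) = \/_i (r_i /\ beta_i(x))] this is
    finite-tier compatibility.  For Scott continuity at a directed set [D],
    let [Z] be the lattice of open maps of [X], with the topology of the
    monotone maps that preserve the join of [D], and let
    [H(z, x) = \/_(d in D, d <= z) d(x)].  Up-sets of members of [D] are open
    in [Z], so that [H] is open; its sections at the members of [D] and at
    the join of [D] are these maps themselves, so openness of
    [z |-> Phi(H(z, _))] says that [Phi] is monotone on [D] and preserves its
    join ([splitting_scott_on]).

    [Sigma X] is a Lowen topology since each of its conditions, for a fixed
    [D] or a fixed tier, defines one, and Lowen topologies are stable under
    inverse images and intersections. *)

Set Implicit Arguments.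
Unset Strict Implicit.
Unset Printing Implicit Defensive.

Import Order.TTheory GRing.Theory Num.Theory.
Local Open Scope classical_set_scope.
Local Open Scope ring_scope.

(** * Joins in the unit interval *)

Section Isup.
Variable R : realType.
Implicit Types (A B : set {i01 R}) (t x y : {i01 R}).

Lemma isup_ub A x : A x -> x <= isup A.
Proof. by case: (isupP A) => + _; exact. Qed.

Lemma isup_le A y : (forall x, A x -> x <= y) -> isup A <= y.
Proof. by case: (isupP A) => _; exact. Qed.

Lemma lt_isup A t : t < isup A -> exists2 x, A x & t < x.
Proof.
move=> tA; apply: contrapT => nA; move: tA; apply/negP; rewrite -leNgt.
apply: isup_le => x Ax; rewrite leNgt; apply/negP => tx.
by apply: nA; exists x.
Qed.

Lemma le_from_lt x y : (forall t, t < x -> t < y) -> x <= y.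
Proof. by move=> h; rewrite leNgt; apply/negP => /h; rewrite ltxx. Qed.

Lemma le_isup A B :
  (forall x, A x -> exists2 y, B y & x <= y) -> isup A <= isup B.
Proof.
move=> AB; apply: isup_le => x /AB[y By /le_trans]; apply.
exact: isup_ub.
Qed.

Lemma i01_le1 x : x <= 1%:i01.
Proof. by rewrite -num_le; exact: le1. Qed.

Lemma i01_ge0 x : 0%:i01 <= x.
Proof. by rewrite -num_le; exact: ge0. Qed.

Lemma pjoin_ub (T : Type) (F : set (T -> {i01 R})) u p :
  F u -> u p <= pjoin F p.
Proof. by move=> Fu; apply: isup_ub; exists u. Qed.

Lemma pjoin_le (T : Type) (F : set (T -> {i01 R})) p y :
  (forall u, F u -> u p <= y) -> pjoin F p <= y.
Proof. by move=> Fy; apply: isup_le => _ [u /Fy ? <-]. Qed.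

Lemma lt_pjoin (T : Type) (F : set (T -> {i01 R})) p t :
  t < pjoin F p -> exists2 u, F u & t < u p.
Proof. by move=> /lt_isup[_ [u Fu <-] tu]; exists u. Qed.

End Isup.

(** * Constructions of Lowen topologies *)

Section LowenConstructions.
Variable R : realType.

Lemma pjoin_comp (T U : Type) (f : T -> U) (F : set (U -> {i01 R})) :
  pjoin F \o f = pjoin [set w \o f | w in F].
Proof.
apply/funext => x; congr isup.
apply/seteqP; split=> [_ [w Fw <-]|_ [_ [w Fw <-] <-]]; last by exists w.
by exists (w \o f) => //; exists w.
Qed.

(** The final topology along [f], by which continuity into a generated
    topology can be tested on generators. *)
Lemma lowen_preimage (T U : Type) (f : T -> U) (tau : set (T -> {i01 R})) :
  lowen_topology tau ->
  lowen_topology [set w : U -> {i01 R} | tau (w \o f)].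
Proof.
case=> tauc tauj taum; split=> [a|F Ftau|u v]; [exact: tauc| |exact: taum].
by rewrite /= pjoin_comp; apply: tauj => _ [w /Ftau ? <-].
Qed.

Lemma lowen_bigcap (T I : Type) (P : set I) (tau : I -> set (T -> {i01 R})) :
  (forall i, P i -> lowen_topology (tau i)) ->
  lowen_topology (\bigcap_(i in P) tau i).
Proof.
move=> tauL; split=> [a i /tauL[]//|F FP i Pi|u v uP vP i Pi].
  by have [_ + _] := tauL i Pi; apply=> u /FP; exact.
by have [_ _ +] := tauL i Pi; apply; [exact: uP|exact: vP].
Qed.

Lemma lowen_setI (T : Type) (tau sigma : set (T -> {i01 R})) :
  lowen_topology tau -> lowen_topology sigma ->
  lowen_topology (tau `&` sigma).
Proof.
move=> [tc tj tm] [sc sj sm]; split=> [a|F Fts|u v [? ?] [? ?]].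
- by split; [exact: tc|exact: sc].
- by split; [apply: tj|apply: sj] => u /Fts[].
- by split; [exact: tm|exact: sm].
Qed.

Lemma generated_sub (T : Type) (G tau : set (T -> {i01 R})) :
  lowen_topology tau -> G `<=` tau -> generated G `<=` tau.
Proof. by move=> tauL Gtau w; apply. Qed.

Lemma sub_generated (T : Type) (G : set (T -> {i01 R})) : G `<=` generated G.
Proof. by move=> w Gw tau [_]; apply. Qed.

Lemma fopen_fst (Z X : lowenType R) (a : Z -> {i01 R}) :
  fopen Z a -> fopen (prod_lowen Z X) (a \o fst).
Proof. by move=> Za; apply: sub_generated; left; exists a. Qed.

Lemma fopen_snd (Z X : lowenType R) (b : X -> {i01 R}) :
  fopen X b -> fopen (prod_lowen Z X) (b \o snd).
Proof. by move=> Xb; apply: sub_generated; right; exists b. Qed.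

Lemma fopen_rect (Z X : lowenType R) (a : Z -> {i01 R}) (b : X -> {i01 R}) :
  fopen Z a -> fopen X b ->
  fopen (prod_lowen Z X) (pmeet (a \o fst) (b \o snd)).
Proof.
move=> Za Xb; have [_ _] := fopenP (prod_lowen Z X).
by apply; [exact: fopen_fst|exact: fopen_snd].
Qed.

Lemma fopen_proj n (i : 'I_n) :
  fopen (pow_lowen n (sierpinski R)) (fun r : 'I_n -> {i01 R} => r i).
Proof.
by apply: sub_generated; exists i => //; exists id => //; exact: sub_generated.
Qed.

Lemma fcontinuous_pow (Z : lowenType R) n (a : 'I_n -> Z -> {i01 R}) :
  (forall i, fopen Z (a i)) ->
  @fcontinuous R Z (pow_lowen n (sierpinski R)) (fun z i => a i z).
Proof.
move=> Za v; apply: (generated_sub (lowen_preimage _ (fopenP Z))).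
move=> _ [i _ [w Sw <-]]; exact: ((fcontinuous_sierpinski (a i)).2 (Za i) _ Sw).
Qed.

Definition rect (Z X : lowenType R) (ab : fopen Z * fopen X) :
  Z * X -> {i01 R} := pmeet (val ab.1 \o fst) (val ab.2 \o snd).

Definition rect_below (Z X : lowenType R) (H : Z * X -> {i01 R}) :
  set (fopen Z * fopen X) := [set ab | forall q, rect ab q <= H q].

(** The strict form makes it evident that the maps with this approximation
    property form a Lowen topology, because the order of the unit interval is
    total: a value below a join is below one of its members, and a value below
    two others is below their minimum. *)
Lemma fopen_prod_rect (Z X : lowenType R) (H : Z * X -> {i01 R}) :
  fopen (prod_lowen Z X) H -> forall p t, t < H p ->
  exists2 ab, rect_below H ab & t < rect ab p.
Proof.
pose tau : set (Z * X -> {i01 R}) := [set K | forall p t, t < K p ->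
  exists2 ab : fopen Z * fopen X, rect_below K ab & t < rect ab p].
move: H; apply: (@generated_sub _ _ tau) => [|_ [[a Za <-]|[b Xb <-]] p t tp].
- split=> [c p t tc|F FP p t tF|u v uP vP p t].
  + exists (fconst _ c, fconst _ c) => [q|] /=.
      by rewrite /rect /pmeet /= minxx.
    by rewrite /rect /pmeet /= minxx.
  + have [u Fu tu] := lt_pjoin tF.
    have [ab abu tab] := FP u Fu p t tu.
    by exists ab => // q; apply: le_trans (abu q) _; exact: pjoin_ub.
  + rewrite {1}/pmeet lt_min => /andP[/uP[ab abu tab] /vP[cd cdv tcd]].
    exists (fmeet ab.1 cd.1, fmeet ab.2 cd.2) => [q|].
      rewrite /rect /pmeet /= /pmeet minACA le_min.
      apply/andP; split; [apply: le_trans (abu q)|apply: le_trans (cdv q)].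
        by rewrite ge_min lexx.
      by rewrite ge_min lexx orbT.
    by rewrite /rect /pmeet /= /pmeet minACA lt_min; apply/andP.
- exists (SigSub (mem_set Za), fconst _ 1%:i01) => [q|] /=; rewrite /rect /pmeet /=.
    by rewrite ge_min lexx.
  by rewrite lt_min tp (lt_le_trans tp) ?i01_le1.
- exists (fconst _ 1%:i01, SigSub (mem_set Xb)) => [q|] /=; rewrite /rect /pmeet /=.
    by rewrite ge_min lexx orbT.
  by rewrite lt_min tp (lt_le_trans tp) ?i01_le1.
Qed.

End LowenConstructions.

(** * Weights form a Lowen topology *)

Section Weights.
Variables (R : realType) (X : lowenType R).
Implicit Types (u v : fopen X) (D : set (fopen X)) (Phi : fopen X -> {i01 R}).

Lemma fle_refl u : fle u u.
Proof. by move=> x. Qed.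

Lemma fjoinE D x : val (fjoin D) x = isup [set val u x | u in D].
Proof.
congr isup; apply/seteqP; split=> [_ [_ [u Du <-] <-]|_ [u Du <-]].
  by exists u.
by exists (val u) => //; exists u.
Qed.

Lemma fjoin_ub D u : D u -> fle u (fjoin D).
Proof. by move=> Du x; rewrite fjoinE; apply: isup_ub; exists u. Qed.

(** Scott continuity at a single directed set; besides cutting [Sigma X] out
    as an intersection, it is the topology of the test spaces of
    [splitting_scott_on]. *)
Definition scott_at D : set (fopen X -> {i01 R}) :=
  [set Phi | (forall u v, fle u v -> Phi u <= Phi v) /\
             Phi (fjoin D) = isup [set Phi u | u in D]].

Lemma scott_at_intro D Phi :
  (forall u v, fle u v -> Phi u <= Phi v) ->
  (forall t, t < Phi (fjoin D) -> exists2 u, D u & t < Phi u) ->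
  scott_at D Phi.
Proof.
move=> PhiM PhiD; split=> //; apply/le_anti/andP; split.
  apply: le_from_lt => t /PhiD[u Du /lt_le_trans]; apply.
  by apply: isup_ub; exists u.
by apply: isup_le => _ [u Du <-]; apply/PhiM/fjoin_ub.
Qed.

Lemma scott_at_lt D Phi t :
  scott_at D Phi -> t < Phi (fjoin D) -> exists2 u, D u & t < Phi u.
Proof. by move=> [_ ->] /lt_isup[_ [u Du <-] tu]; exists u. Qed.

Lemma scott_at_lowen D : fdirected D -> lowen_topology (scott_at D).
Proof.
move=> [[d0 Dd0] dirD].
split=> [a|F FD|Phi Psi PhiD PsiD]; apply: scott_at_intro.
- by [].
- by move=> t ta; exists d0.
- move=> u v uv; apply: pjoin_le => Phi FPhi.
  by apply: le_trans (pjoin_ub _ FPhi); exact: (FD _ FPhi).1.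
- move=> t tF; have [Phi FPhi tPhi] := lt_pjoin tF.
  have [u Du tu] := scott_at_lt (FD _ FPhi) tPhi.
  by exists u => //; apply: lt_le_trans tu _; exact: pjoin_ub.
- by move=> u v uv; rewrite /pmeet le_min !ge_min PhiD.1 //= PsiD.1 ?orbT.
- move=> t; rewrite {1}/pmeet lt_min.
  move=> /andP[/(scott_at_lt PhiD)[u Du tu] /(scott_at_lt PsiD)[v Dv tv]].
  have [w [Dw uw vw]] := dirD u v Du Dv.
  exists w; rewrite ///pmeet lt_min (lt_le_trans tu) ?PhiD.1 //=.
  by rewrite (lt_le_trans tv) ?PsiD.1.
Qed.

Definition tier n (beta : 'I_n -> fopen X) (r : 'I_n -> {i01 R}) : fopen X :=
  fjoin (range (fun i => fmeet (fconst X (r i)) (beta i))).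

Lemma tierE n (beta : 'I_n -> fopen X) r x :
  val (tier beta r) x =
  isup (range (fun i => Order.min (r i) (val (beta i) x))).
Proof.
rewrite fjoinE; congr isup; apply/seteqP; split.
  by move=> _ [_ [i _ <-] <-]; exists i.
by move=> _ [i _ <-]; eexists; first by exists i.
Qed.

Lemma scott_continuousE Phi :
  scott_continuous Phi <-> forall D, fdirected D -> scott_at D Phi.
Proof.
split=> [[PhiM PhiD] D dirD|PhiD]; first by split=> //; exact: PhiD.
split=> [|D /PhiD[]//].
have /PhiD[] // : fdirected [set fconst X 0%:i01].
split=> [|u v -> ->]; first by exists (fconst X 0%:i01).
by exists (fconst X 0%:i01); split => //; exact: fle_refl.
Qed.

Lemma Sigma_lowen : lowen_topology (Sigma X).
Proof.
pose ftc (k : {n & 'I_n -> fopen X}) :=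
  [set Phi : fopen X -> {i01 R} |
    fopen (pow_lowen (tag k) (sierpinski R)) (Phi \o tier (tagged k))].
have -> : Sigma X = (\bigcap_(D in fdirected (X := X)) scott_at D) `&`
    \bigcap_(k in [set k | (0 < tag k)%N]) ftc k.
  apply/seteqP; split=> Phi [PhiS PhiF]; split.
  - exact/scott_continuousE.
  - by case=> n beta /= n0; exact: PhiF.
  - exact/scott_continuousE.
  - by move=> n beta n0; exact: (PhiF (Tagged _ beta)).
apply: lowen_setI; first by apply: lowen_bigcap => D; exact: scott_at_lowen.
by apply: lowen_bigcap => k _; exact: lowen_preimage (fopenP _).
Qed.

Lemma SigmaCE (Psi : cmaps X (sierpinski R) -> {i01 R}) :
  SigmaC X Psi <-> Sigma X (Psi \o @cmap_of_fopen R X).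
Proof.
split=> [[Phi PhiS <-]|PsiS].
  suff -> : (Phi \o @fopen_of_cmap R X) \o @cmap_of_fopen R X = Phi by [].
  by apply/funext => u /=; rewrite cmap_of_fopenK.
exists (Psi \o @cmap_of_fopen R X) => //.
by apply/funext => f /=; rewrite fopen_of_cmapK.
Qed.

Lemma SigmaC_lowen : lowen_topology (SigmaC X).
Proof.
have -> : SigmaC X =
    [set Psi : cmaps X (sierpinski R) -> {i01 R} |
      Sigma X (Psi \o @cmap_of_fopen R X)].
  by apply/seteqP; split=> Psi /SigmaCE.
exact: lowen_preimage Sigma_lowen.
Qed.

End Weights.

(** * Weights are splitting *)

Section Splitting.
Variables (R : realType) (X Z : lowenType R).

Variables (H : Z * X -> {i01 R}) (HO : fopen (prod_lowen Z X) H).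

Definition rect_tier n (ab : 'I_n -> fopen Z * fopen X) (z : Z) : fopen X :=
  tier (fun i => (ab i).2) (fun i => val (ab i).1 z).

(** Families are taken nonempty, as finite-tier compatibility speaks of
    nonempty tiers only. *)
Definition rect_tiers (z : Z) : set (fopen X) :=
  [set w | exists n (ab : 'I_n -> fopen Z * fopen X),
     [/\ (0 < n)%N, forall i, rect_below H (ab i) & w = rect_tier ab z]].

Lemma rect_tiers_directed z : fdirected (rect_tiers z).
Proof.
split.
  exists (rect_tier (fun _ : 'I_1 => (fconst Z 0%:i01, fconst X 0%:i01)) z).
  exists 1%N, (fun=> (fconst Z 0%:i01, fconst X 0%:i01)); split=> // _ q.
  by rewrite /rect /pmeet /= minxx i01_ge0.
move=> _ _ [n [ab [n0 abH ->]]] [m [cd [m0 cdH ->]]].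
pose ef (k : 'I_(n + m)) :=
  match fintype.split k with inl i => ab i | inr j => cd j end.
exists (rect_tier ef z); split.
- exists (n + m)%N, ef; split=> // [|k]; first by rewrite addn_gt0 n0.
  by rewrite /ef; case: fintype.split.
- move=> x; rewrite /rect_tier !tierE; apply: le_isup => _ [i _ <-].
  exists (Order.min (val (ab i).1 z) (val (ab i).2 x)) => //.
  by exists (lshift m i) => //; rewrite /ef (unsplitK (inl i)).
- move=> x; rewrite /rect_tier !tierE; apply: le_isup => _ [j _ <-].
  exists (Order.min (val (cd j).1 z) (val (cd j).2 x)) => //.
  by exists (rshift n j) => //; rewrite /ef (unsplitK (inr j)).
Qed.

Lemma fjoin_rect_tiers z x : val (fjoin (rect_tiers z)) x = H (z, x).
Proof.
rewrite fjoinE; apply/le_anti/andP; split.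
  apply: isup_le => _ [_ [n [ab [_ abH ->]]] <-].
  rewrite /rect_tier tierE; apply: isup_le => _ [i _ <-].
  exact: abH i (z, x).
apply: le_from_lt => t /(fopen_prod_rect HO)[ab abH /lt_le_trans]; apply.
have : val (rect_tier (fun _ : 'I_1 => ab) z) x <=
    isup [set val u x | u in rect_tiers z].
  apply: isup_ub; exists (rect_tier (fun _ : 'I_1 => ab) z) => //.
  by exists 1%N, (fun=> ab).
apply: le_trans; rewrite /rect_tier tierE; apply: isup_ub.
by exists ord0.
Qed.

Lemma fopen_weight_section (Phi : fopen X -> {i01 R}) (s : Z -> fopen X) :
  Sigma X Phi -> (forall z x, val (s z) x = H (z, x)) -> fopen Z (Phi \o s).
Proof.
move=> [[_ PhiD] PhiF] sH.
pose F := [set g : Z -> {i01 R} | exists n (ab : 'I_n -> fopen Z * fopen X),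
  [/\ (0 < n)%N, forall i, rect_below H (ab i) & g = Phi \o rect_tier ab]].
suff -> : Phi \o s = pjoin F.
  have [_ + _] := fopenP Z; apply=> _ [n [ab [n0 _ ->]]].
  apply: (@fcontinuous_pow R Z n (fun i => val (ab i).1)) (PhiF _ _ n0).
  by move=> i; exact: set_valP.
apply/funext => z.
have -> : (Phi \o s) z = Phi (fjoin (rect_tiers z)).
  congr Phi; apply/val_inj/funext => x.
  by rewrite fjoin_rect_tiers sH.
rewrite PhiD; last exact: rect_tiers_directed.
congr isup; apply/seteqP; split=> [_ [_ [n [ab [n0 abH ->]]] <-]|].
  by exists (Phi \o rect_tier ab) => //; exists n, ab.
move=> _ [_ [n [ab [n0 abH ->]]] <-].
by exists (rect_tier ab z) => //; exists n, ab.
Qed.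

End Splitting.

(** * Splitting topologies consist of weights *)

Section Largest.
Variables (R : realType) (X : lowenType R).
Variables (eta : set (cmaps X (sierpinski R) -> {i01 R})).
Hypothesis etaL : lowen_topology eta.
Hypothesis eta_splitting : splitting etaL.
Variable Psi : cmaps X (sierpinski R) -> {i01 R}.
Hypothesis etaPsi : eta Psi.

Local Notation Phi := (Psi \o @cmap_of_fopen R X).

Lemma splitting_open_section (Z : lowenType R) (H : Z * X -> {i01 R}) :
  fopen (prod_lowen Z X) H ->
  exists2 g : Z -> {i01 R}, fopen Z g &
    forall z u, (forall x, val u x = H (z, x)) -> g z = Phi u.
Proof.
move=> HO.
pose Hc := (fcontinuous_sierpinski (X := prod_lowen Z X) H).2 HO.
exists (Psi \o transpose Hc); first exact: (eta_splitting Hc etaPsi).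
move=> z u uH; congr Psi; apply/val_inj/funext => x.
by rewrite /= uH.
Qed.

Lemma splitting_ftc : finite_tier_compatible Phi.
Proof.
move=> n beta _.
pose H (p : ('I_n -> {i01 R}) * X) := val (tier beta p.1) p.2.
have HO : fopen (prod_lowen (pow_lowen n (sierpinski R)) X) H.
  have -> : H = pjoin (range (fun i : 'I_n =>
      pmeet ((fun r : 'I_n -> {i01 R} => r i) \o fst) (val (beta i) \o snd))).
    apply/funext => -[r x]; rewrite /H tierE; congr isup.
    apply/seteqP; split=> [_ [i _ <-]|_ [_ [i _ <-] <-]]; last by exists i.
    by eexists; first by exists i.
  have [_ + _] := fopenP (prod_lowen (pow_lowen n (sierpinski R)) X).
  apply=> _ [i _ <-]; apply: (@fopen_rect R (pow_lowen n (sierpinski R)) X).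
    exact: fopen_proj.
  exact: set_valP.
have [g gO gE] := splitting_open_section HO.
have <- : g = (fun r => Phi (tier beta r)) by apply/funext => r; exact: gE.
exact: gO.
Qed.

Definition upset (d : fopen X) : fopen X -> {i01 R} :=
  fun z => if `[< fle d z >] then 1%:i01 else 0%:i01.

Lemma upset_scott_at (D : set (fopen X)) d : D d -> scott_at D (upset d).
Proof.
move=> Dd; apply: scott_at_intro => [u v uv|t].
  rewrite /upset; case: asboolP => [du|_]; last exact: i01_ge0.
  case: asboolP => // -[] x; exact: le_trans (du x) (uv x).
move=> /lt_le_trans/(_ (i01_le1 _)) t1; exists d => //.
by rewrite /upset; case: asboolP => // -[]; exact: fle_refl.
Qed.

(** Testing against the space [Z] of maps that are Scott-continuous at [D] only,
    rather than at every directed set, is what makes the up-sets of members of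
    [D] open.  In return, [H] is the evaluation map only over [D] and its join,
    and nothing is learnt about [Phi] elsewhere. *)
Lemma splitting_scott_on (D : set (fopen X)) : fdirected D ->
  exists2 g, scott_at D g &
    g (fjoin D) = Phi (fjoin D) /\ forall d, D d -> g d = Phi d.
Proof.
move=> dirD; pose Z := LowenType (scott_at_lowen dirD).
pose H : Z * X -> {i01 R} := pjoin
  [set pmeet (upset d \o fst) (val d \o snd) | d in D].
have HO : fopen (prod_lowen Z X) H.
  have [_ + _] := fopenP (prod_lowen Z X); apply=> _ [d Dd <-].
  apply: (@fopen_rect R Z X); last exact: set_valP.
  exact: upset_scott_at.
have [g gO gE] := splitting_open_section HO.
have leH d z x : D d -> fle d z -> val d x <= H (z, x).
  move=> Dd dz; apply: le_trans (pjoin_ub (u := pmeet _ _) _ _); last first.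
    by exists d.
  rewrite /pmeet /= /upset; case: asboolP => // _.
  by rewrite le_min i01_le1 lexx.
have geH z x : H (z, x) <= val z x.
  apply: pjoin_le => _ [d Dd <-]; rewrite /pmeet /= /upset ge_min.
  by case: asboolP => [->|_]; rewrite ?orbT ?i01_ge0.
exists g => //; split=> [|d Dd]; apply: gE => x; apply/le_anti; rewrite geH.
  rewrite andbT fjoinE; apply: isup_le => _ [d Dd <-].
  by apply: leH => //; exact: fjoin_ub.
by rewrite andbT; apply: leH => //; exact: fle_refl.
Qed.

Lemma splitting_scott : scott_continuous Phi.
Proof.
split=> [u v uv|D dirD].
  (* A comparable pair is directed, so monotonicity is an instance of the
     behaviour of Phi on directed sets. *)
  have dirD : fdirected [set u; v].
    split; first by exists u; left.
    move=> a b Da Db; exists v.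
    by split; [right|case: Da => ->|case: Db => ->] => //; exact: fle_refl.
  have [g [gM _] [_ gE]] := splitting_scott_on dirD.
  rewrite -(gE u (or_introl erefl)) -(gE v (or_intror erefl)).
  exact: gM.
have [g [_ gD] [gJ gE]] := splitting_scott_on dirD.
rewrite -gJ gD; congr isup.
by apply/seteqP; split=> _ [d Dd <-]; exists d; rewrite ?gE.
Qed.

End Largest.

Theorem theorem4p4 (R : realType) (X : lowenType R) :
  exists SigmaL : lowen_topology (SigmaC X),
    splitting SigmaL /\
    forall (eta : set (cmaps X (sierpinski R) -> {i01 R}))
           (etaL : lowen_topology eta),
      splitting etaL -> eta `<=` SigmaC X.
Proof.
exists (SigmaC_lowen X); split=> [Z H Hc Psi /= [Phi PhiS <-]|].
  have HO := (fcontinuous_sierpinski (X := prod_lowen Z X) H).1 Hc.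
  exact: (fopen_weight_section HO (s := @fopen_of_cmap R X \o transpose Hc)).
move=> eta etaL etaS Psi etaPsi; apply/SigmaCE; split.
  exact: splitting_scott etaS _ etaPsi.
exact: splitting_ftc etaS _ etaPsi.
Qed.
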